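(* Let $\mathfrak{m}$ be a finitely presented Lie algebra over a field $\mathbb{K}$ and let $i$ be a natural number. Then the following are equivalent: (i) $\gamma_{i+1}(\mathfrak{m})$ is finitely presented; (ii) there exists an $i$-central extension $0\to\mathfrak{r}\to\mathfrak{l}\to\mathfrak{m}\to 0$ of Lie algebras such that $\gamma_{i+1}(\mathfrak{l})$ is finitely presented; (iii) for every $i$-central extension $0\to\mathfrak{r}\to\mathfrak{l}\to\mathfrak{m}\to 0$ of Lie algebras, $\gamma_{i+1}(\mathfrak{l})$ is finitely presented.
   Context: $\mathbb{K}$ is a field; Lie algebras are over $\mathbb{K}$, and ''finitely presented'' means finitely presented as a Lie algebra. The lower central series of a Lie algebra $\mathfrak{m}$ is $\gamma_1(\mathfrak{m})=\mathfrak{m}$, $\gamma_{i+1}(\mathfrak{m})=[\gamma_i(\mathfrak{m}),\mathfrak{m}]$ for $i\ge 1$. For an ideal $\mathfrak{r}$ of a Lie algebra $\mathfrak{l}$, define $\gamma_1(\mathfrak{r},\mathfrak{l})=\mathfrak{r}$ and $\gamma_{i+1}(\mathfrak{r},\mathfrak{l})=[\gamma_i(\mathfrak{r},\mathfrak{l}),\mathfrak{l}]$ for $i\ge1$. An extension (short exact sequence) of Lie algebras $0\to\mathfrak{r}\to\mathfrak{l}\to\mathfrak{m}\to0$ is $i$-central if $\gamma_{i+1}(\mathfrak{r},\mathfrak{l})=0$. *)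

(* Defs.v *)
From HB Require Import structures.
From mathcomp Require Import all_boot all_order all_algebra.
From mathcomp Require Import boolp classical_sets functions.

Set Implicit Arguments.
Unset Strict Implicit.
Unset Printing Implicit Defensive.

Import GRing.Theory.
Local Open Scope ring_scope.
Local Open Scope classical_set_scope.

(** * Lie algebras of arbitrary dimension over a field *)

HB.mixin Record Lmodule_isLie (K : fieldType) L of GRing.Lmodule K L := {
  lie_bracket : L -> L -> L;
  lie_linearl : forall (a : K) (x y z : L),
    lie_bracket (a *: x + y) z = a *: lie_bracket x z + lie_bracket y z;
  lie_linearr : forall (a : K) (x y z : L),
    lie_bracket x (a *: y + z) = a *: lie_bracket x y + lie_bracket x z;
  lie_bracketxx : forall x : L, lie_bracket x x = 0;
  lie_jacobi : forall x y z : L,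
    lie_bracket x (lie_bracket y z) + lie_bracket y (lie_bracket z x)
      + lie_bracket z (lie_bracket x y) = 0
}.

#[short(type="lieType")]
HB.structure Definition LieAlgebra (K : fieldType) :=
  {L of GRing.Lmodule K L & Lmodule_isLie K L}.

Notation "⁅ x , y ⁆" := (lie_bracket x y)
  (at level 0, x at level 99, y at level 99, format "⁅ x ,  y ⁆") : ring_scope.

HB.mixin Record isLieMorphism (K : fieldType) (L M : lieType K) (f : L -> M) := {
  lie_morph_bracket : {morph f : x y / ⁅x, y⁆}
}.

#[short(type="lieHom")]
HB.structure Definition LieMorphism (K : fieldType) (L M : lieType K) :=
  {f of @GRing.Linear K L M *:%R f & isLieMorphism K L M f}.

(** * Subspaces, ideals and subalgebras, as subsets of a Lie algebra *)

Section Subsets.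
Context {K : fieldType} {L : lieType K}.
Implicit Types A B S : set L.

Definition is_subspace A :=
  A 0 /\ forall (a : K) x y, A x -> A y -> A (a *: x + y).

Definition is_subalgebra A :=
  is_subspace A /\ forall x y, A x -> A y -> A ⁅x, y⁆.

Definition is_ideal A :=
  is_subspace A /\ forall x y, A x -> A ⁅x, y⁆.

Definition ideal_generated S : set L := smallest is_ideal S.

(** [[A, B]] is the linear span of the brackets, not the set of brackets. *)
Definition commutator A B : set L :=
  smallest is_subspace [set z | exists x y, [/\ A x, B y & z = ⁅x, y⁆]].

(** [rel_gamma A i] is gamma_i(A, L): gamma_1(A, L) = A and
    gamma_(i+1)(A, L) = [gamma_i(A, L), L]. Indices start at 1; the value at 0
    is a junk value. *)
Definition rel_gamma A (i : nat) : set L :=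
  iter i.-1 (fun B => commutator B setT) A.

Lemma smallest_subspace S : is_subspace (smallest is_subspace S).
Proof.
split=> [B [[]]//|a x y Sx Sy B BS].
have [[_ Blin] _] := BS; apply: Blin; [exact: (Sx B)|exact: (Sy B)].
Qed.

Lemma ideal_subalgebra A : is_ideal A -> is_subalgebra A.
Proof. by move=> [? Aid]; split=> // x y Ax _; exact: Aid. Qed.

Lemma is_idealT : is_ideal setT.
Proof. by []. Qed.

Lemma commutator_ideal A : is_ideal A -> is_ideal (commutator A setT).
Proof.
move=> [Asub Aid]; split=> [|x y]; first exact: smallest_subspace.
have CA : commutator A setT `<=` A.
  by move=> z; apply: smallest_sub => // t [u [v [Au _ ->]]]; exact: Aid.
by move=> /CA Ax; apply: sub_gen_smallest; exists x, y.
Qed.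

Lemma rel_gamma_ideal A i : is_ideal A -> is_ideal (rel_gamma A i).
Proof.
by move=> Aid; rewrite /rel_gamma; elim: i.-1 => //= n; exact: commutator_ideal.
Qed.

End Subsets.

(** * Subalgebras as Lie algebras *)

Record subalgebra (K : fieldType) (L : lieType K) := Subalgebra {
  subalgebra_set : set L;
  subalgebraP : is_subalgebra subalgebra_set
}.

Section SubalgebraType.
Context {K : fieldType} {L : lieType K}.
Variable A : subalgebra L.

Definition subalgebra_pred : {pred L} := fun x => `[< subalgebra_set A x >].

Fact subalgebra_pred_closed : GRing.subsemimod_closed subalgebra_pred.
Proof.
have [[A0 Alin] _] := subalgebraP A.
split; first split=> [|x y /asboolP Ax /asboolP Ay]; first exact/asboolP.
  by apply/asboolP; rewrite -[x]scale1r; exact: Alin.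
by move=> a x /asboolP Ax; apply/asboolP; rewrite -[_ *: _]addr0; exact: Alin.
Qed.

HB.instance Definition _ :=
  GRing.isSubmodClosed.Build K L subalgebra_pred subalgebra_pred_closed.

Record sub_lie := SubLie {
  sub_lie_val :> L;
  sub_lieP : sub_lie_val \in subalgebra_pred
}.

HB.instance Definition _ := [isSub for sub_lie_val].
HB.instance Definition _ := [Choice of sub_lie by <:].
HB.instance Definition _ := [SubChoice_isSubLmodule of sub_lie by <:].

Fact sub_bracket_subproof (x y : sub_lie) : ⁅val x, val y⁆ \in subalgebra_pred.
Proof.
by apply/asboolP; apply: (subalgebraP A).2; apply/asboolP; exact: sub_lieP.
Qed.

Definition sub_bracket (x y : sub_lie) : sub_lie :=
  SubLie (sub_bracket_subproof x y).

Fact sub_linearl (a : K) (x y z : sub_lie) :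
  sub_bracket (a *: x + y) z = a *: sub_bracket x z + sub_bracket y z.
Proof. by apply: val_inj; rewrite /= lie_linearl. Qed.

Fact sub_linearr (a : K) (x y z : sub_lie) :
  sub_bracket x (a *: y + z) = a *: sub_bracket x y + sub_bracket x z.
Proof. by apply: val_inj; rewrite /= lie_linearr. Qed.

Fact sub_bracketxx (x : sub_lie) : sub_bracket x x = 0.
Proof. by apply: val_inj; rewrite /= lie_bracketxx. Qed.

Fact sub_jacobi (x y z : sub_lie) :
  sub_bracket x (sub_bracket y z) + sub_bracket y (sub_bracket z x)
    + sub_bracket z (sub_bracket x y) = 0.
Proof. by apply: val_inj; rewrite /= lie_jacobi. Qed.

HB.instance Definition _ := Lmodule_isLie.Build K sub_lie
  sub_linearl sub_linearr sub_bracketxx sub_jacobi.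

End SubalgebraType.

(** [lie_gamma L i] is gamma_i(L), for i >= 1, with its Lie algebra structure. *)
Definition lie_gamma (K : fieldType) (L : lieType K) (i : nat) : lieType K :=
  sub_lie (Subalgebra
    (ideal_subalgebra (rel_gamma_ideal (L := L) i is_idealT))).

(** * Free Lie algebras: formal expressions modulo the Lie algebra laws *)

Inductive lie_term (K : fieldType) (X : Type) : Type :=
| TVar of X
| TZero
| TOpp of lie_term K X
| TAdd of lie_term K X & lie_term K X
| TScale of K & lie_term K X
| TBracket of lie_term K X & lie_term K X.
Arguments TVar {K X}.
Arguments TZero {K X}.

Section FreeLie.
Variables (K : fieldType) (X : Type).
Local Notation term := (lie_term K X).
Implicit Types (a b : K) (s t u : term).

Inductive lie_eqv : term -> term -> Prop :=
| eqv_refl t : lie_eqv t t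
| eqv_sym s t : lie_eqv s t -> lie_eqv t s
| eqv_trans s t u : lie_eqv s t -> lie_eqv t u -> lie_eqv s u
| eqv_opp s t : lie_eqv s t -> lie_eqv (TOpp s) (TOpp t)
| eqv_add s s' t t' :
    lie_eqv s s' -> lie_eqv t t' -> lie_eqv (TAdd s t) (TAdd s' t')
| eqv_scale a s t : lie_eqv s t -> lie_eqv (TScale a s) (TScale a t)
| eqv_bracket s s' t t' :
    lie_eqv s s' -> lie_eqv t t' -> lie_eqv (TBracket s t) (TBracket s' t')
| eqv_addA s t u : lie_eqv (TAdd s (TAdd t u)) (TAdd (TAdd s t) u)
| eqv_addC s t : lie_eqv (TAdd s t) (TAdd t s)
| eqv_add0 t : lie_eqv (TAdd TZero t) t
| eqv_addN t : lie_eqv (TAdd (TOpp t) t) TZero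
| eqv_scaleA a b t : lie_eqv (TScale a (TScale b t)) (TScale (a * b) t)
| eqv_scale1 t : lie_eqv (TScale 1 t) t
| eqv_scaleDr a s t :
    lie_eqv (TScale a (TAdd s t)) (TAdd (TScale a s) (TScale a t))
| eqv_scaleDl t a b :
    lie_eqv (TScale (a + b) t) (TAdd (TScale a t) (TScale b t))
| eqv_linearl a s t u :
    lie_eqv (TBracket (TAdd (TScale a s) t) u)
            (TAdd (TScale a (TBracket s u)) (TBracket t u))
| eqv_linearr a s t u :
    lie_eqv (TBracket s (TAdd (TScale a t) u))
            (TAdd (TScale a (TBracket s t)) (TBracket s u))
| eqv_bracketxx t : lie_eqv (TBracket t t) TZero
| eqv_jacobi s t u :
    lie_eqv (TAdd (TAdd (TBracket s (TBracket t u))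
                        (TBracket t (TBracket u s)))
                  (TBracket u (TBracket s t))) TZero.

HB.instance Definition _ := gen_eqMixin term.
HB.instance Definition _ := gen_choiceMixin term.

Definition lie_eqb : rel term := fun s t => `[< lie_eqv s t >].

Fact lie_eqb_equiv : equiv_class_of lie_eqb.
Proof.
split=> [t|s t|t s u].
- exact/asboolP/eqv_refl.
- by apply/asboolP/asboolP; exact: eqv_sym.
- by move=> /asboolP st /asboolP tu; apply/asboolP; exact: eqv_trans tu.
Qed.

Canonical lie_eqb_equiv_rel := EquivRelPack lie_eqb_equiv.

Definition free_lie : Type := {eq_quot lie_eqb}%qT.
HB.instance Definition _ := EqQuotient.on free_lie.
HB.instance Definition _ := Choice.on free_lie.

Local Notation cls := (\pi_free_lie%qT).

Fact free_eqP s t : cls s = cls t <-> lie_eqv s t.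
Proof. by split=> [/eqquotP/asboolP|st]//; apply/eqquotP/asboolP. Qed.

Fact free_reprP t : lie_eqv (repr (cls t)) t.
Proof. by apply/free_eqP; rewrite reprK. Qed.

Definition free_zero : free_lie := cls TZero.
Definition free_opp (x : free_lie) : free_lie :=
  locked (cls (TOpp (repr x))).
Definition free_add (x y : free_lie) : free_lie :=
  locked (cls (TAdd (repr x) (repr y))).
Definition free_scale a (x : free_lie) : free_lie :=
  locked (cls (TScale a (repr x))).
Definition free_bracket (x y : free_lie) : free_lie :=
  locked (cls (TBracket (repr x) (repr y))).

Fact free_oppE t : free_opp (cls t) = cls (TOpp t).
Proof. by rewrite /free_opp -lock; exact/free_eqP/eqv_opp/free_reprP. Qed.

Fact free_addE s t : free_add (cls s) (cls t) = cls (TAdd s t).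
Proof.
by rewrite /free_add -lock; apply/free_eqP/eqv_add; exact: free_reprP.
Qed.

Fact free_scaleE a t : free_scale a (cls t) = cls (TScale a t).
Proof. by rewrite /free_scale -lock; exact/free_eqP/eqv_scale/free_reprP. Qed.

Fact free_bracketE s t : free_bracket (cls s) (cls t) = cls (TBracket s t).
Proof.
by rewrite /free_bracket -lock; apply/free_eqP/eqv_bracket; exact: free_reprP.
Qed.

Let freeE := (free_oppE, free_addE, free_scaleE, free_bracketE).

Fact free_addA : associative free_add.
Proof.
elim/quotW=> s; elim/quotW=> t; elim/quotW=> u.
by rewrite !freeE; exact/free_eqP/eqv_addA.
Qed.

Fact free_addC : commutative free_add.
Proof.
by elim/quotW=> s; elim/quotW=> t; rewrite !freeE; exact/free_eqP/eqv_addC.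
Qed.

Fact free_add0 : left_id free_zero free_add.
Proof. by elim/quotW=> t; rewrite !freeE; exact/free_eqP/eqv_add0. Qed.

Fact free_addN : left_inverse free_zero free_opp free_add.
Proof. by elim/quotW=> t; rewrite !freeE; exact/free_eqP/eqv_addN. Qed.

HB.instance Definition _ :=
  GRing.isZmodule.Build free_lie free_addA free_addC free_add0 free_addN.

Fact free_scaleA a b (x : free_lie) :
  free_scale a (free_scale b x) = free_scale (a * b) x.
Proof. by elim/quotW: x => t; rewrite !freeE; exact/free_eqP/eqv_scaleA. Qed.

Fact free_scale1 : left_id 1 free_scale.
Proof. by elim/quotW=> t; rewrite !freeE; exact/free_eqP/eqv_scale1. Qed.

Fact free_scaleDr : right_distributive free_scale +%R.
Proof.
move=> a; elim/quotW=> s; elim/quotW=> t.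
by rewrite ![GRing.add _ _]freeE !freeE [RHS]freeE; exact/free_eqP/eqv_scaleDr.
Qed.

Fact free_scaleDl (x : free_lie) :
  {morph free_scale^~ x : a b / a + b}.
Proof.
move=> a b; elim/quotW: x => t.
by rewrite !freeE [RHS]freeE; exact/free_eqP/eqv_scaleDl.
Qed.

HB.instance Definition _ := GRing.Zmodule_isLmodule.Build K free_lie
  free_scaleA free_scale1 free_scaleDr free_scaleDl.

Fact free_addrE s t : cls s + cls t = cls (TAdd s t).
Proof. exact: free_addE. Qed.

Fact free_scalerE a t : a *: cls t = cls (TScale a t).
Proof. exact: free_scaleE. Qed.

Fact free_linearl a (x y z : free_lie) :
  free_bracket (a *: x + y) z = a *: free_bracket x z + free_bracket y z.
Proof.
elim/quotW: x => s; elim/quotW: y => t; elim/quotW: z => u.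
by rewrite !(free_scalerE, free_addrE, freeE); exact/free_eqP/eqv_linearl.
Qed.

Fact free_linearr a (x y z : free_lie) :
  free_bracket x (a *: y + z) = a *: free_bracket x y + free_bracket x z.
Proof.
elim/quotW: x => s; elim/quotW: y => t; elim/quotW: z => u.
by rewrite !(free_scalerE, free_addrE, freeE); exact/free_eqP/eqv_linearr.
Qed.

Fact free_bracketxx (x : free_lie) : free_bracket x x = 0.
Proof. by elim/quotW: x => t; rewrite !freeE; exact/free_eqP/eqv_bracketxx. Qed.

Fact free_jacobi (x y z : free_lie) :
  free_bracket x (free_bracket y z) + free_bracket y (free_bracket z x)
    + free_bracket z (free_bracket x y) = 0.
Proof.
elim/quotW: x => s; elim/quotW: y => t; elim/quotW: z => u.
by rewrite !(free_addrE, freeE); exact/free_eqP/eqv_jacobi.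
Qed.

HB.instance Definition _ := Lmodule_isLie.Build K free_lie
  free_linearl free_linearr free_bracketxx free_jacobi.

Definition free_gen (x : X) : free_lie := cls (TVar x).

End FreeLie.

(** [free_lie K X] has the universal property of the free Lie algebra on [X]. *)
Section FreeLieUniversal.
Context {K : fieldType} {X : Type} {L : lieType K}.
Variable g : X -> L.

Fixpoint term_eval (t : lie_term K X) : L :=
  match t with
  | TVar x => g x
  | TZero => 0
  | TOpp s => - term_eval s
  | TAdd s u => term_eval s + term_eval u
  | TScale a s => a *: term_eval s
  | TBracket s u => ⁅term_eval s, term_eval u⁆
  end.

Fact term_eval_eqv s t : lie_eqv s t -> term_eval s = term_eval t.
Proof.
elim=> {s t} //=; do ?by move=> *; congruence.
- by move=> *; rewrite addrA.
- by move=> *; rewrite addrC.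
- by move=> *; rewrite add0r.
- by move=> *; rewrite addNr.
- by move=> *; rewrite scalerA.
- by move=> *; rewrite scale1r.
- by move=> *; rewrite scalerDr.
- by move=> *; rewrite scalerDl.
- by move=> *; rewrite lie_linearl.
- by move=> *; rewrite lie_linearr.
- by move=> *; rewrite lie_bracketxx.
- by move=> *; rewrite lie_jacobi.
Qed.

Definition free_lift (x : free_lie K X) : L := term_eval (repr x).

Fact free_liftE t : free_lift (\pi_(free_lie K X)%qT t) = term_eval t.
Proof. exact/term_eval_eqv/free_reprP. Qed.

Fact free_lift_linear : linear free_lift.
Proof.
move=> a; elim/quotW=> s; elim/quotW=> t.
by rewrite free_scalerE free_addrE !free_liftE.
Qed.

HB.instance Definition _ :=
  GRing.isLinear.Build K (free_lie K X) L *:%R free_lift free_lift_linear.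

Fact free_lift_morph : {morph free_lift : x y / ⁅x, y⁆}.
Proof.
elim/quotW=> s; elim/quotW=> t.
by rewrite [X in free_lift X]free_bracketE !free_liftE.
Qed.

HB.instance Definition _ :=
  isLieMorphism.Build K (free_lie K X) L free_lift free_lift_morph.

Lemma free_lift_gen x : free_lift (free_gen K x) = g x.
Proof. exact: free_liftE. Qed.

Lemma free_lift_unique (f : lieHom (free_lie K X) L) :
  (forall x, f (free_gen K x) = g x) -> f =1 free_lift.
Proof.
move=> fg; elim/quotW; elim=> [x||s IH|s IHs t IHt|a s IH|s IHs t IHt].
- by rewrite fg free_lift_gen.
- by rewrite !(raddf0 f) [RHS]raddf0.
- rewrite -free_oppE [LHS](raddfN f) [RHS](raddfN free_lift).
  by congr (- _); exact: IH.
- rewrite -free_addrE [LHS](raddfD f) [RHS](raddfD free_lift).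
  by congr (_ + _); [exact: IHs|exact: IHt].
- rewrite -free_scalerE [LHS](linearZ_LR f) [RHS](linearZ_LR free_lift).
  by congr (_ *: _); exact: IH.
- rewrite -free_bracketE [LHS](lie_morph_bracket (s := f)).
  rewrite [RHS](lie_morph_bracket (s := free_lift)).
  by congr (⁅_, _⁆); [exact: IHs|exact: IHt].
Qed.

End FreeLieUniversal.

(** * Finite presentations *)

(** [L] is isomorphic to the quotient of a free Lie algebra on finitely many
    generators by the ideal generated by finitely many relators. *)
Definition finitely_presented (K : fieldType) (L : lieType K) : Prop :=
  exists (n : nat) (rels : seq (free_lie K 'I_n)) (f : lieHom (free_lie K 'I_n) L),
    range f = setT /\ f @^-1` [set 0] = ideal_generated [set` rels].

(** * Extensions *)

Section Extensions.
Context {K : fieldType} {r l m : lieType K}.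
Implicit Types (iota : lieHom r l) (pi : lieHom l m).

(** Exactness of 0 -> r -> l -> m -> 0. *)
Definition lie_extension iota pi : Prop :=
  [/\ injective iota, range iota = pi @^-1` [set 0] & range pi = setT].

(** [r] is identified with the ideal [range iota] of [l]. *)
Definition central_extension (i : nat) iota pi : Prop :=
  lie_extension iota pi /\ rel_gamma (range iota) i.+1 = [set 0].

End Extensions.

(* Main.v *)
From HB Require Import structures.
Require Import Defs.
From mathcomp Require Import all_boot all_algebra.
From mathcomp Require Import boolp classical_sets functions.

(** Every [i]-central extension [pi : l -> m] induces a surjection of
    gamma_(i+1)(l) onto gamma_(i+1)(m), and when [m] is finitely presented the
    kernel of that surjection is finite-dimensional. Since a surjection with
    finite-dimensional kernel preserves and reflects finite presentability
    ([fp_quotient], [fp_extension]), each of the three conditions is equivalent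
    to gamma_(i+1)(m) being finitely presented; the extension of [m] by 0
    provides the witness for (ii) and the instance of (iii) that are needed.

    Finiteness of the kernel ([gamma_map_finite_kernel]) is where the finite
    presentation of [m] enters. Write [m] as F/R with F free on finitely many
    generators and R generated as an ideal by finitely many relators, and lift
    F -> m to [g : F -> l]. The relators land in the kernel r of [pi], so an
    iterated bracket of a relator with at least [i] generators of F lands in
    gamma_(i+1)(r, l) = 0. As R is spanned by the iterated brackets of relators
    with generators, g(R) is finite-dimensional ([central_ideal_finite]). On the
    other hand l = g(F) + r, and a bracket of [i+1] elements of [l], one of which
    lies in r, belongs to gamma_(i+1)(r, l) = 0; hence gamma_(i+1)(l) is
    g(gamma_(i+1)(F)) ([rel_gamma_sum]). Therefore the kernel of
    gamma_(i+1)(l) -> gamma_(i+1)(m) is contained in r meet g(F), which is g(R). *)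

Set Implicit Arguments.
Unset Strict Implicit.
Unset Printing Implicit Defensive.

Section Preliminaries.
Import GRing.Theory.
Local Open Scope ring_scope.
Local Open Scope classical_set_scope.

(** * Subspaces and finite spans *)

Section Subspaces.
Context {K : fieldType} {L : lieType K}.
Implicit Types (A B J : set L) (s : seq L).

Lemma subspaceZD A a x y : is_subspace A -> A x -> A y -> A (a *: x + y).
Proof. by move=> [_ Alin]; exact: Alin. Qed.

Lemma subspaceZ A a x : is_subspace A -> A x -> A (a *: x).
Proof. by move=> [A0 Alin] Ax; rewrite -[_ *: _]addr0; exact: Alin. Qed.

Lemma subspaceD A x y : is_subspace A -> A x -> A y -> A (x + y).
Proof. by move=> [_ Alin] Ax Ay; rewrite -[x]scale1r; exact: Alin. Qed.

Lemma subspaceN A x : is_subspace A -> A x -> A (- x).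
Proof. by move=> sA; rewrite -scaleN1r; exact: subspaceZ. Qed.

Lemma subspaceB A x y : is_subspace A -> A x -> A y -> A (x - y).
Proof. by move=> sA Ax Ay; apply: subspaceD => //; exact: subspaceN. Qed.

Definition span s : set L := smallest is_subspace [set` s].

Lemma span_subspace s : is_subspace (span s).
Proof. exact: smallest_subspace. Qed.

Lemma mem_span s x : x \in s -> span s x.
Proof. by move=> xs; exact: sub_gen_smallest. Qed.

Lemma span_sub s A : is_subspace A -> {in s, forall x, A x} -> span s `<=` A.
Proof. by move=> sA ssA; apply: smallest_sub => // x /= /ssA. Qed.

Lemma span_mono s t : {subset s <= t} -> span s `<=` span t.
Proof.
move=> st; apply: span_sub => [|x /st]; first exact: span_subspace.
exact: mem_span.
Qed.

Lemma span_nil : span [::] `<=` [set 0].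
Proof.
apply: span_sub => //; split=> // a x y -> ->.
by rewrite scaler0 addr0.
Qed.

Lemma span_cons v s x :
  span (v :: s) x -> exists a, exists2 y, span s y & x = a *: v + y.
Proof.
move: x; apply: span_sub => [|x]; first split.
- by exists 0, 0; [exact: (span_subspace s).1|rewrite scale0r addr0].
- move=> a _ _ [b [y sy ->]] [c [z sz ->]].
  exists (a * b + c), (a *: y + z); first exact: (span_subspace s).2.
  by rewrite scalerDr scalerA scalerDl addrACA.
rewrite inE => /orP[/eqP->|xs].
  by exists 1, 0; [exact: (span_subspace s).1|rewrite scale1r addr0].
by exists 0, x; [exact: mem_span|rewrite scale0r add0r].
Qed.

Definition sum_set A B : set L := [set a + b | a in A & b in B].

Lemma sum_setl A B x : is_subspace B -> A x -> sum_set A B x.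
Proof. by move=> sB Ax; exists x => //; exists 0; [exact: sB.1|rewrite addr0]. Qed.

Lemma sum_setr A B x : is_subspace A -> B x -> sum_set A B x.
Proof. by move=> sA Bx; exists 0; [exact: sA.1|exists x; rewrite ?add0r]. Qed.

Lemma sum_set_subspace A B :
  is_subspace A -> is_subspace B -> is_subspace (sum_set A B).
Proof.
move=> sA sB; split; first by apply: sum_setl => //; exact: sA.1.
move=> a _ _ [x Ax [y By <-]] [z Az [t Bt <-]].
exists (a *: x + z); first exact: sA.2.
by exists (a *: y + t); [exact: sB.2|rewrite scalerDr addrACA].
Qed.

End Subspaces.

Lemma image_subspace (K : fieldType) (L V : lieType K) (u : {linear L -> V})
    (A : set L) :
  is_subspace A -> is_subspace (u @` A).
Proof.
move=> sA; split; first by exists 0; [exact: sA.1|rewrite raddf0].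
move=> a _ _ [x Ax <-] [y Ay <-]; exists (a *: x + y); last by rewrite linearP.
exact: subspaceZD.
Qed.

Lemma span_map (K : fieldType) (L V : lieType K) (u : {linear L -> V}) (s : seq L) :
  span (map u s) = u @` span s.
Proof.
apply/seteqP; split.
  apply: span_sub => [|_ /mapP[x xs ->]]; last by exists x => //; exact: mem_span.
  by apply: image_subspace; exact: span_subspace.
move=> _ [x sx <-]; move: x sx; apply: span_sub => [|x xs]; last first.
  by apply: mem_span; exact: map_f.
split; first by rewrite /= raddf0; exact: (span_subspace _).1.
by move=> a x y sx sy; rewrite /= linearP; exact: (subspaceZD _ (span_subspace _)).
Qed.

(** With [u] the identity this says that a subspace of a finite-dimensional
    space is finite-dimensional; in general, that a subspace with
    finite-dimensional image is spanned, modulo the kernel of [u], by finitely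
    many of its own elements. The proof removes one vector of [w]
    at a time, in the manner of Gaussian elimination. *)
Lemma lift_finite_span (K : fieldType) (U V : lieType K) (u : {linear U -> V})
    (A : set U) (w : seq V) :
    is_subspace A -> (forall a, A a -> span w (u a)) ->
  exists2 s : seq U, {in s, forall x, A x}
    & forall a, A a -> exists2 b, span s b & u a = u b.
Proof.
elim: w A => [|v w IHw] A sA uA.
  exists [::] => // a /uA/span_nil ->.
  by exists 0; [exact: (span_subspace _).1|rewrite raddf0].
have sA' : is_subspace [set a | A a /\ span w (u a)].
  split=> [|c x y [Ax wx] [Ay wy]].
    by rewrite /= raddf0; split; [exact: sA.1|exact: (span_subspace w).1].
  split; first exact: sA.2.
  by rewrite linearP; exact: (span_subspace w).2.
have [a []//|s sA's spans] := IHw _ sA'.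
have [[a Aa wua]|nwu] := pselect (exists2 a, A a & ~ span w (u a)); last first.
  exists s => [x /sA's[]//|a Aa]; apply: spans; split=> //.
  by apply: contrapT => wua; apply: nwu; exists a.
have [c [y wy uaE]] := span_cons (uA _ Aa).
(* [v] occurs in [u a], so [a] serves as a pivot: subtracting a multiple of it
   brings the image of any element of [A] into the span of [w]. *)
have c0 : c != 0.
  by apply: contra_notN wua => /eqP c0; rewrite uaE c0 scale0r add0r.
exists (a :: s) => [x|b Ab]; first by rewrite inE => /orP[/eqP->//|/sA's[]].
have [d [z wz ubE]] := span_cons (uA _ Ab).
have [|e se ebE] := spans (b - (d / c) *: a).
  split; first by apply: subspaceB => //; exact: subspaceZ.
  rewrite linearB linearZ /= ubE uaE scalerDr scalerA divfK // opprD addrACA.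
  rewrite subrr add0r; apply: (subspaceB (span_subspace w)) => //.
  by apply: (subspaceZ _ (span_subspace w)).
exists ((d / c) *: a + e).
  apply: (subspaceZD _ (span_subspace _)).
    by apply: mem_span; rewrite inE eqxx.
  by apply: span_mono se => x xs; rewrite inE xs orbT.
by rewrite linearD /= -ebE linearB /= addrC subrK.
Qed.

(** * Brackets and ideals *)

Section Brackets.
Context {K : fieldType} {L : lieType K}.
Implicit Types (x y z : L) (A B J : set L) (s : seq L).

Lemma lieDl x y z : ⁅x + y, z⁆ = ⁅x, z⁆ + ⁅y, z⁆.
Proof. by rewrite -[x]scale1r lie_linearl !scale1r. Qed.

Lemma lieDr x y z : ⁅x, y + z⁆ = ⁅x, y⁆ + ⁅x, z⁆.
Proof. by rewrite -[y]scale1r lie_linearr !scale1r. Qed.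

Lemma lie0l x : ⁅0, x⁆ = 0.
Proof. by apply: (addrI ⁅0, x⁆); rewrite -lieDl !addr0. Qed.

Lemma lie0r x : ⁅x, 0⁆ = 0.
Proof. by apply: (addrI ⁅x, 0⁆); rewrite -lieDr !addr0. Qed.

Lemma lieNr x y : ⁅x, - y⁆ = - ⁅x, y⁆.
Proof. by apply/eqP; rewrite -addr_eq0 -lieDr addNr lie0r. Qed.

Lemma lieNl x y : ⁅- x, y⁆ = - ⁅x, y⁆.
Proof. by apply/eqP; rewrite -addr_eq0 -lieDl addNr lie0l. Qed.

Lemma lieC x y : ⁅x, y⁆ = - ⁅y, x⁆.
Proof.
apply/eqP; rewrite -addr_eq0; apply/eqP.
by rewrite -(lie_bracketxx (x + y)) lieDl !lieDr !lie_bracketxx add0r addr0.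
Qed.

Lemma lie_leibniz x y z : ⁅x, ⁅y, z⁆⁆ = ⁅⁅x, y⁆, z⁆ - ⁅⁅x, z⁆, y⁆.
Proof.
have /eqP := lie_jacobi x y z; rewrite -addrA addr_eq0 => /eqP ->.
by rewrite opprD addrC (lieC ⁅x, y⁆ z) (lieC ⁅x, z⁆ y) (lieC x z) lieNr opprK.
Qed.

Lemma idealr J x y : is_ideal J -> J x -> J ⁅y, x⁆.
Proof. by move=> [sJ Jid] Jx; rewrite lieC; apply: subspaceN => //; exact: Jid. Qed.

Lemma ideal_generatedP (S : set L) : is_ideal (ideal_generated S).
Proof.
split; first split.
- by move=> J [[[]]].
- move=> a x y Sx Sy J JS; have [[[_ Jlin] _] _] := JS.
  by apply: Jlin; [exact: Sx|exact: Sy].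
- by move=> x y Sx J JS; apply: JS.1.2; exact: Sx.
Qed.

Lemma mem_ideal_generated s x : x \in s -> ideal_generated [set` s] x.
Proof. by move=> xs; exact: sub_gen_smallest. Qed.

Lemma ideal_generated_sub s J :
  is_ideal J -> {in s, forall x, J x} -> ideal_generated [set` s] `<=` J.
Proof. by move=> iJ sJ; apply: smallest_sub => // x /= /sJ. Qed.

Lemma span_ideal_generated s : span s `<=` ideal_generated [set` s].
Proof.
apply: span_sub => [|x]; last exact: mem_ideal_generated.
by case: (ideal_generatedP [set` s]).
Qed.

End Brackets.

Section Morphisms.
Context {K : fieldType}.

Lemma set0_ideal (L : lieType K) : is_ideal [set 0 : L].
Proof.
split; first by split=> // a x y -> ->; rewrite scaler0 addr0.
by move=> x y ->; rewrite lie0l.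
Qed.

Section Preimage.
Variables (L M : lieType K) (f : lieHom L M).

Lemma preimage_ideal (J : set M) : is_ideal J -> is_ideal (f @^-1` J).
Proof.
move=> [sJ Jid]; split; first split.
- by rewrite /preimage /= raddf0; exact: sJ.1.
- by move=> a x y Jx Jy; rewrite /preimage /= linearP; exact: sJ.2.
- by move=> x y Jx; rewrite /preimage /= lie_morph_bracket; exact: Jid.
Qed.

Lemma ker_ideal : is_ideal (f @^-1` [set 0]).
Proof. by apply: preimage_ideal; exact: set0_ideal. Qed.

End Preimage.

Section Composition.
Variables (L M N : lieType K) (g : lieHom M N) (f : lieHom L M).

Fact comp_lie_morph : {morph g \o f : x y / ⁅x, y⁆}.
Proof. by move=> x y /=; rewrite !lie_morph_bracket. Qed.

HB.instance Definition _ := isLieMorphism.Build K L N (g \o f) comp_lie_morph.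

End Composition.

Section Identity.
Variable L : lieType K.

Fact idfun_lie_morph : {morph (@idfun L) : x y / ⁅x, y⁆}.
Proof. by []. Qed.

HB.instance Definition _ := isLieMorphism.Build K L L idfun idfun_lie_morph.

End Identity.

Section Inclusion.
Variables (L : lieType K) (A : subalgebra L).

Fact sub_lie_val_linear : linear (@sub_lie_val K L A).
Proof. by []. Qed.

HB.instance Definition _ :=
  GRing.isLinear.Build K (sub_lie A) L *:%R (@sub_lie_val K L A) sub_lie_val_linear.

Fact sub_lie_val_morph : {morph (@sub_lie_val K L A) : x y / ⁅x, y⁆}.
Proof. by []. Qed.

HB.instance Definition _ :=
  isLieMorphism.Build K (sub_lie A) L (@sub_lie_val K L A) sub_lie_val_morph.

End Inclusion.
End Morphisms.

(** * Generators of a free Lie algebra *)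

Section Free.
Context {K : fieldType}.

Lemma free_lie_ind (X : Type) (A : set (free_lie K X)) :
  is_subalgebra A -> (forall x, A (free_gen K x)) -> forall y, A y.
Proof.
move=> [sA Abr] Agen; elim/quotW.
elim=> [x||s IH|s IHs t IHt|a s IH|s IHs t IHt].
- exact: Agen.
- exact: sA.1.
- by rewrite -free_oppE; exact: subspaceN sA IH.
- by rewrite -free_addrE; exact: subspaceD.
- by rewrite -free_scalerE; exact: subspaceZ.
- by rewrite -free_bracketE; exact: Abr.
Qed.

Lemma free_hom_exists (X : Type) (L : lieType K) (g : X -> L) :
  exists f : lieHom (free_lie K X) L, forall x, f (free_gen K x) = g x.
Proof. by exists (free_lift g) => x; exact: free_lift_gen. Qed.

Lemma free_hom_ext (X : Type) (L : lieType K) (f g : lieHom (free_lie K X) L) :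
  (forall x, f (free_gen K x) = g (free_gen K x)) -> f =1 g.
Proof.
move=> fg x; rewrite (free_lift_unique (f := f) fg).
by rewrite -(free_lift_unique (f := g)).
Qed.

(** The elements whose right bracket preserves a given subspace form a
    subalgebra, by the Jacobi identity; hence invariance needs to be tested on
    generators only. *)
Lemma free_ideal (X : Type) (A : set (free_lie K X)) :
    is_subspace A -> (forall a x, A a -> A ⁅a, free_gen K x⁆) -> is_ideal A.
Proof.
move=> sA Agen; split=> // a x; move: x a.
apply: free_lie_ind => [|x a]; last exact: Agen.
split; first split.
- by move=> a _; rewrite lie0r; exact: sA.1.
- by move=> c x y Ax Ay a Aa; rewrite lie_linearr; apply: sA.2; [exact: Ax|exact: Ay].
- move=> x y Ax Ay a Aa; rewrite lie_leibniz.
  by apply: subspaceB => //; [apply/Ay/Ax|apply/Ax/Ay].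
Qed.

Lemma span_add_ideal (X : Type) (c : seq (free_lie K X)) (J : set (free_lie K X)) :
    is_ideal J ->
    {in c, forall t, forall x, sum_set (span c) J ⁅t, free_gen K x⁆} ->
  is_ideal (sum_set (span c) J).
Proof.
move=> iJ cS.
have sS : is_subspace (sum_set (span c) J).
  by apply: sum_set_subspace iJ.1; exact: span_subspace.
apply: free_ideal => // _ x [a ca [b Jb <-]]; rewrite lieDl.
apply: subspaceD => //; last first.
  by apply: sum_setr; [exact: span_subspace|exact: iJ.2].
move: a ca; apply: span_sub => [|t /cS]; last exact.
split; first by rewrite /= lie0l; exact: sS.1.
by move=> e y z Sy Sz; rewrite /= lie_linearl; exact: sS.2.
Qed.

End Free.

(** * Finite presentability and finite-dimensional kernels *)

Section FiniteKernel.
Context {K : fieldType} {B A : lieType K}.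
Variables (p : lieHom B A) (z : seq B).
Hypothesis p_surj : range p = setT.
Hypothesis kerp : p @^-1` [set 0] `<=` span z.

(** It suffices to add to the relators of [B] lifts of finitely many elements
    spanning the kernel of [p]. *)
Lemma fp_quotient : finitely_presented B -> finitely_presented A.
Proof.
move=> [n [rels [f [f_surj kerf]]]].
have iker := ker_ideal (p \o f).
have [||s sker spans] := @lift_finite_span _ _ _ f ((p \o f) @^-1` [set 0]) z.
- exact: iker.1.
- by move=> a; exact: kerp.
exists n, (rels ++ s), (p \o f); split.
  by rewrite -p_surj -(image_comp f p) f_surj.
apply/seteqP; split=> [a pfa|].
  have [b sb fab] := spans a pfa.
  rewrite -(subrK b a); apply: (subspaceD (ideal_generatedP _).1).
    have : ideal_generated [set` rels] (a - b).
      by rewrite -kerf /= linearB /= fab subrr.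
    apply: ideal_generated_sub => [|x xr]; first exact: ideal_generatedP.
    by apply: mem_ideal_generated; rewrite mem_cat xr.
  apply: span_ideal_generated; apply: span_mono sb => x xs.
  by rewrite mem_cat xs orbT.
apply: ideal_generated_sub => // x; rewrite mem_cat => /orP[xr|/sker//].
have /= : (f @^-1` [set 0]) x by rewrite kerf; exact: mem_ideal_generated.
by move=> /= ->; rewrite raddf0.
Qed.

(** Take the generators of [A], lifted to [B], together with new generators [c]
    for a spanning family of the kernel of [p]. A relator of [A], and the bracket
    of an element of [c] with any generator, take values in the kernel, hence
    agree in [B] with linear combinations of [c]. The finitely many equations
    saying so generate an ideal [J] such that [span c + J] is the whole kernel
    of the map to [A]. The kernel of the map to [B] lies between [J] and
    [span c + J], so over [J] it is generated by a subspace of the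
    finite-dimensional space [span c]. *)
Lemma fp_extension : finitely_presented A -> finitely_presented B.
Proof.
move=> [n [rels [f [f_surj kerf]]]].
have iker := ker_ideal p.
have [s sker spans] := @lift_finite_span _ _ _ idfun _ z iker.1 kerp.
have {}spans a : p a = 0 -> span s a by move=> /spans[b sb /= ->].
have /choice[b pb] : forall j : 'I_n, exists x, p x = f (free_gen K j).
  move=> j; have [x _ <-] : range p (f (free_gen K j)) by rewrite p_surj.
  by exists x.
set d := size s.
have [h hE] := free_hom_exists (fun k : 'I_(n + d) =>
  match fintype.split k with inl j => b j | inr t => s`_t end).
have [phi phiE] := free_hom_exists (fun j : 'I_n => free_gen K (lshift d j)).
have [rho rhoE] := free_hom_exists (fun k : 'I_(n + d) =>
  match fintype.split k with inl j => free_gen K j | inr t => 0 end).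
pose c := [seq free_gen K (rshift n t) | t <- enum 'I_d].
have hl j : h (free_gen K (lshift d j)) = b j by rewrite hE (unsplitK (inl j)).
have hr t : h (free_gen K (rshift n t)) = s`_t by rewrite hE (unsplitK (inr t)).
have rhol j : rho (free_gen K (lshift d j)) = free_gen K j.
  by rewrite rhoE (unsplitK (inl j)).
have rhor t : rho (free_gen K (rshift n t)) = 0 by rewrite rhoE (unsplitK (inr t)).
have hc : map h c = s.
  rewrite -map_comp -[RHS](mkseq_nth 0) /mkseq -val_enum_ord -map_comp.
  by apply: eq_map => t /=; rewrite hr.
have liftc a : p a = 0 -> exists2 u, span c u & h u = a.
  by move=> /spans; rewrite -hc span_map => -[u cu <-]; exists u.
have phE : p \o h =1 f \o rho.
  apply: free_hom_ext => k /=; rewrite -(splitK k).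
  case: (fintype.split k) => [j|t] /=; first by rewrite hl rhol pb.
  by rewrite hr rhor raddf0; apply/sker/mem_nth.
have h_phi x : p (h (phi x)) = f x.
  rewrite -[LHS]/((p \o h) (phi x)) phE /=; congr (f _).
  apply: (free_hom_ext (f := rho \o phi) (g := idfun)) => j /=.
  by rewrite phiE rhol.
(* [tau y] is a combination of the new generators with the same value as [y]
   in [B], for [y] mapping to 0 in [A]. *)
have /choice[tau tauP] (y : free_lie K 'I_(n + d)) :
    exists u, p (h y) = 0 -> span c u /\ h u = h y.
  have [/liftc[u cu hu]|phy] := eqVneq (p (h y)) 0; first by exists u.
  by exists 0 => /eqP; rewrite (negPf phy).
have c_ker t : t \in c -> p (h t) = 0.
  by move=> tc; apply: sker; rewrite -hc map_f.
pose Y := map phi rels ++ [seq ⁅t, free_gen K k⁆ | t <- c, k <- enum 'I_(n + d)].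
have Yker y : y \in Y -> p (h y) = 0.
  rewrite mem_cat => /orP[/mapP[x xr ->]|/allpairsP[[t k] [/= tc _ ->]]].
    rewrite h_phi; suff: (f @^-1` [set 0]) x by [].
    by rewrite kerf; exact: mem_ideal_generated.
  by rewrite !lie_morph_bracket c_ker // lie0l.
pose relsY := [seq y - tau y | y <- Y].
pose J := ideal_generated [set` relsY].
have iJ : is_ideal J by exact: ideal_generatedP.
have ikerh := ker_ideal h.
have relsY_ker : {in relsY, forall y, (h @^-1` [set 0]) y}.
  by move=> _ /mapP[y /Yker/tauP[_ hy] ->]; rewrite /= linearB /= hy subrr.
have Jker : J `<=` h @^-1` [set 0] by apply: ideal_generated_sub.
(* [S] will turn out to be the kernel of the map to [A]: it is an ideal that
   contains [c] and the relators of [A], hence modulo it every element agrees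
   with its retraction to the free algebra on the generators of [A]. *)
pose S := sum_set (span c) J.
have YS y : y \in Y -> S y.
  move=> yY; have [ctau _] := tauP _ (Yker _ yY).
  exists (tau y) => //; exists (y - tau y); last by rewrite addrC subrK.
  by apply: mem_ideal_generated; apply: map_f.
have iS : is_ideal S.
  apply: span_add_ideal => // t tc k; apply: YS; rewrite mem_cat; apply/orP; right.
  by apply: allpairs_f => //; rewrite mem_enum.
have retract x : S (x - phi (rho x)).
  move: x; apply: free_lie_ind => [|k]; last first.
    rewrite -(splitK k); case: (fintype.split k) => [j|t] /=.
      by rewrite rhol phiE subrr; exact: iS.1.1.
    rewrite rhor raddf0 subr0; apply: sum_setl; first exact: iJ.1.
    by apply: mem_span; apply: map_f; rewrite mem_enum.
  split=> [|x y Sx Sy]; first split; first by rewrite /= !raddf0 addr0; exact: iS.1.1.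
    move=> a x y Sx Sy; rewrite /= (linearP rho) (linearP phi) opprD addrACA -scalerBr.
    exact: (subspaceZD _ iS.1).
  rewrite /= !lie_morph_bracket -[X in S X](subrKA ⁅phi (rho x), y⁆).
  rewrite -lieNr -lieDr -lieNl -lieDl.
  by apply: (subspaceD iS.1); [exact: iS.2|exact: idealr].
have kerS x : p (h x) = 0 -> S x.
  move=> phx; rewrite -(subrK (phi (rho x)) x); apply: (subspaceD iS.1) => //.
  have : ideal_generated [set` rels] (rho x).
    by rewrite -kerf; rewrite /= -[LHS]/((f \o rho) x) -phE.
  apply: (ideal_generated_sub (J := phi @^-1` S)); first exact: preimage_ideal.
  by move=> y yr; apply: YS; rewrite mem_cat map_f.
(* What [J] misses of the kernel of [h] consists of linear relations between
   the images of the new generators. *)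
have ssub : is_subspace (h @^-1` [set 0] `&` span c).
  split; first by split; [exact: ikerh.1.1|exact: (span_subspace c).1].
  move=> a x y [hx cx] [hy cy]; split; first exact: (subspaceZD _ ikerh.1).
  exact: (subspaceZD _ (span_subspace c)).
have [a []//|s2 s2ker spans2] := @lift_finite_span _ _ _ idfun _ c ssub.
exists (n + d)%N, (s2 ++ relsY), h; split.
  apply/seteqP; split=> // x _.
  have [y _ fy] : range f (p x) by rewrite f_surj.
  have [|u _ hu] := liftc (x - h (phi y)); first by rewrite linearB /= h_phi fy subrr.
  by exists (phi y + u) => //; rewrite linearD /= hu addrC subrK.
apply/seteqP; split=> [x hx|]; last first.
  apply: ideal_generated_sub => // x; rewrite mem_cat => /orP[/s2ker[]//|].
  exact: relsY_ker.
have [|u cu [v Jv xE]] := kerS x; first by rewrite hx raddf0.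
rewrite -xE; apply: (subspaceD (ideal_generatedP _).1).
  have [|u' su uE] := spans2 u.
    by split=> //; rewrite /= -(addrK v u) xE linearB /= hx (Jker _ Jv) subrr.
  rewrite (uE : u = u'); apply: span_ideal_generated; apply: span_mono su => y ys.
  by rewrite mem_cat ys.
apply: ideal_generated_sub Jv => [|y yY]; first exact: ideal_generatedP.
by apply: mem_ideal_generated; rewrite mem_cat yY orbT.
Qed.

End FiniteKernel.

(** * Lower central series *)

Section LowerCentral.
Context {K : fieldType}.

Section Gamma.
Context {L : lieType K}.
Implicit Types A S : set L.

Lemma rel_gammaS A i x y : rel_gamma A i.+1 x -> rel_gamma A i.+2 ⁅x, y⁆.
Proof. by move=> Ax; apply: sub_gen_smallest; exists x, y. Qed.

Lemma rel_gamma_min A i S :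
    is_subspace S -> (forall x y, rel_gamma A i.+1 x -> S ⁅x, y⁆) ->
  rel_gamma A i.+2 `<=` S.
Proof. by move=> sS AS; apply: smallest_sub => // _ [x [y [Ax _ ->]]]; exact: AS. Qed.

(** The Jacobi identity moves one factor of [y] at a time over to [x], at the
    price of shifting the index of [x] by one; hence the induction on [k] has to
    be uniform in [j]. *)
Lemma rel_gamma_bracket A j k x y : is_ideal A ->
  rel_gamma A j.+1 x -> rel_gamma setT k.+1 y -> rel_gamma A (j + k).+2 ⁅x, y⁆.
Proof.
move=> iA; have gA l := (rel_gamma_ideal l iA).1.
elim: k j x y => [|k IHk] j x y Ax; first by move=> _; rewrite addn0; exact: rel_gammaS.
have sS : is_subspace
    [set y | forall x, rel_gamma A j.+1 x -> rel_gamma A (j + k.+1).+2 ⁅x, y⁆].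
  split=> [t _|a t u St Su v Av]; first by rewrite lie0r; exact: (gA _).1.
  by rewrite lie_linearr; apply: (subspaceZD _ (gA _)); [exact: St|exact: Su].
move=> Ty; move: y Ty x Ax; apply: rel_gamma_min => // y z Ty x Ax.
rewrite lie_leibniz addnS; apply: (subspaceB (gA _)).
  by apply: rel_gammaS; exact: IHk.
by rewrite -addSn; apply: IHk => //; exact: rel_gammaS.
Qed.

Lemma rel_gamma0 i : rel_gamma [set 0 : L] i.+1 = [set 0].
Proof.
have i0 : is_ideal [set 0 : L] by exact: set0_ideal.
apply/seteqP; split=> [|_ ->]; last exact: (rel_gamma_ideal _ i0).1.1.
elim: i => [//|i IHi]; apply: rel_gamma_min; first exact: i0.1.
by move=> x y /IHi ->; rewrite /= lie0l.
Qed.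

End Gamma.

Lemma rel_gamma_hom (L M : lieType K) (f : lieHom L M) i :
  forall x, rel_gamma setT i.+1 x -> rel_gamma setT i.+1 (f x).
Proof.
elim: i => [//|i IHi].
have [[M0 Mlin] _] := rel_gamma_ideal i.+2 (is_idealT (L := M)).
apply: rel_gamma_min => [|x y Lx]; last first.
  by rewrite lie_morph_bracket; apply: rel_gammaS; exact: IHi.
split; first by rewrite raddf0.
by move=> a x y Lx Ly; rewrite linearP; exact: Mlin.
Qed.

(** Modulo gamma_(i+1)(r, M), an iterated bracket of [i+1] elements of
    [M = f(L) + r] depends only on their components in [f(L)], because a bracket
    with an entry in [r] lies in gamma_(i+1)(r, M) wherever that entry is. *)
Lemma rel_gamma_sum (L M : lieType K) (f : lieHom L M) (r : set M) i :
    is_ideal r -> (forall y, sum_set (range f) r y) ->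
  rel_gamma setT i.+1 `<=` sum_set (f @` rel_gamma setT i.+1) (rel_gamma r i.+1).
Proof.
move=> ir fr; elim: i => [//|i IHi].
have gr := (rel_gamma_ideal i.+2 ir).1.
apply: rel_gamma_min.
  apply: sum_set_subspace gr; apply: image_subspace.
  exact: (rel_gamma_ideal i.+2 is_idealT).1.
move=> _ y /IHi[_ [u Lu <-] [a ra <-]].
have [_ [v _ <-] [b rb yE]] := fr y.
exists (f ⁅u, v⁆); first by exists ⁅u, v⁆ => //; exact: rel_gammaS.
exists (⁅f u, b⁆ + ⁅a, y⁆); last first.
  by rewrite lie_morph_bracket addrA -lieDr yE lieDl.
(* Here the entry from [r] is the last one, after an element of gamma_(i+1)(M). *)
apply: (subspaceD gr); last exact: rel_gammaS.
rewrite lieC; apply: (subspaceN gr).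
by apply: (rel_gamma_bracket (j := 0)) => //; exact: rel_gamma_hom.
Qed.

Lemma lie_gammaP (L : lieType K) i (x : lie_gamma L i) :
  rel_gamma setT i (sub_lie_val x).
Proof. exact/asboolP/(sub_lieP x). Qed.

Section GammaMap.
Variables (L M : lieType K) (f : lieHom L M) (i : nat).

Fact gamma_map_subproof (x : lie_gamma L i.+1) :
  f (sub_lie_val x) \in subalgebra_pred (Subalgebra
    (ideal_subalgebra (rel_gamma_ideal (L := M) i.+1 is_idealT))).
Proof. by apply/asboolP; apply: rel_gamma_hom; exact: lie_gammaP. Qed.

Definition gamma_map (x : lie_gamma L i.+1) : lie_gamma M i.+1 :=
  SubLie (gamma_map_subproof x).

Fact gamma_map_linear : linear gamma_map.
Proof. by move=> a x y; apply: val_inj; rewrite /= linearP. Qed.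

HB.instance Definition _ :=
  GRing.isLinear.Build K (lie_gamma L i.+1) (lie_gamma M i.+1) *:%R
    gamma_map gamma_map_linear.

Fact gamma_map_morph : {morph gamma_map : x y / ⁅x, y⁆}.
Proof. by move=> x y; apply: val_inj; rewrite /= lie_morph_bracket. Qed.

HB.instance Definition _ :=
  isLieMorphism.Build K (lie_gamma L i.+1) (lie_gamma M i.+1)
    gamma_map gamma_map_morph.

Lemma gamma_map_surj : range f = setT -> range gamma_map = setT.
Proof.
move=> f_surj; apply/seteqP; split=> // y _.
have [|_ [x Lx <-] [b]] := rel_gamma_sum (f := f) (set0_ideal M) _ (lie_gammaP y).
  by move=> z; apply: sum_setl; [exact: (set0_ideal M).1|rewrite f_surj].
rewrite rel_gamma0 => -> yE.
have xP : x \in subalgebra_pred (Subalgebra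
    (ideal_subalgebra (rel_gamma_ideal (L := L) i.+1 is_idealT))) by exact/asboolP.
by exists (SubLie xP) => //; apply: val_inj; rewrite /= -yE addr0.
Qed.

End GammaMap.

(** * Finite-dimensional kernels from central extensions *)

(** The ideal generated by [s] is the span of [s] plus the ideal generated by
    the brackets of elements of [s] with generators, and these brackets lie one
    step further down the series gamma(r, l). After [j] steps the values under
    [g] vanish, so that only finitely many spanning vectors were collected. *)
Lemma central_ideal_finite (n : nat) (l : lieType K)
    (g : lieHom (free_lie K 'I_n) l) (r : set l) j k
    (s : seq (free_lie K 'I_n)) :
    {in s, forall x, rel_gamma r k.+1 (g x)} ->
    rel_gamma r (k + j).+1 = [set 0] ->
  exists w, forall x, ideal_generated [set` s] x -> span w (g x).
Proof.
elim: j k s => [|j IHj] k s sr.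
  rewrite addn0 => r0; exists [::] => x sx; suff -> : g x = 0.
    exact: (span_subspace _).1.
  move: x sx; apply: ideal_generated_sub; last by move=> x /sr; rewrite r0.
  exact: (ker_ideal _).
rewrite addnS -addSn => r0.
pose s' := [seq ⁅t, free_gen K x⁆ | t <- s, x <- enum 'I_n].
have [|w sw] := IHj k.+1 s' _ r0.
  move=> _ /allpairsP[[t x] [/= ts _ ->]].
  by rewrite lie_morph_bracket; apply: rel_gammaS; exact: sr.
exists (map g s ++ w) => x sx.
have [a sa [b sb <-]] : sum_set (span s) (ideal_generated [set` s']) x.
  move: x sx; have is' := ideal_generatedP [set` s'].
  apply: ideal_generated_sub => [|t ts]; last first.
    by apply: sum_setl; [exact: is'.1|exact: mem_span].
  apply: span_add_ideal => // t ts k'; apply: sum_setr; first exact: span_subspace.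
  by apply: mem_ideal_generated; apply: allpairs_f; rewrite ?mem_enum.
rewrite linearD; apply: (subspaceD (span_subspace _)).
  apply: (span_mono (s := map g s)) => [y ys|]; first by rewrite mem_cat ys.
  by rewrite span_map; exists a.
by apply: span_mono (sw _ sb) => y yw; rewrite mem_cat yw orbT.
Qed.

Section CentralExtension.
Context {r l m : lieType K}.
Variables (i : nat) (iota : lieHom r l) (pi : lieHom l m).
Hypothesis m_fp : finitely_presented m.
Hypothesis ext : central_extension i iota pi.

Lemma gamma_map_finite_kernel :
  exists z, @gamma_map _ _ pi i @^-1` [set 0] `<=` span z.
Proof.
have [[_ kerpi pi_surj]] := ext; rewrite kerpi; set k := _ @^-1` _ => k0.
have [n [rels [f [f_surj kerf]]]] := m_fp.
have ik : is_ideal k by exact: ker_ideal.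
have /choice[b pb] : forall j : 'I_n, exists x, pi x = f (free_gen K j).
  move=> j; have [x _ <-] : range pi (f (free_gen K j)) by rewrite pi_surj.
  by exists x.
have [g gE] := free_hom_exists b.
have pgE : pi \o g =1 f.
  by apply: free_hom_ext => j /=; rewrite gE pb.
have [|w relw] := central_ideal_finite (g := g) (k := 0) (s := rels) _ k0.
  move=> x xr; rewrite /rel_gamma /k /= -[LHS]/((pi \o g) x) pgE.
  suff : (f @^-1` [set 0]) x by [].
  by rewrite kerf; exact: mem_ideal_generated.
have iker := ker_ideal (@gamma_map _ _ pi i).
have [a qa|z _ zP] := @lift_finite_span _ _ _ (@sub_lie_val K l _) _ w iker.1.
  have [|_ [u _ <-] [c]] := rel_gamma_sum (f := g) ik _ (lie_gammaP a).
    move=> y; have [u _ fu] : range f (pi y) by rewrite f_surj.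
    exists (g u); first by exists u.
    exists (y - g u); last by rewrite addrC subrK.
    by rewrite /k /= linearB /= -fu -pgE subrr.
  rewrite k0 => ->; rewrite addr0 => aE.
  move: (relw u); rewrite aE; apply; rewrite -kerf /= -pgE /= aE.
  by have /= := congr1 (@sub_lie_val K m _) qa.
by exists z => a /zP[e ze /val_inj ->].
Qed.

Lemma central_extension_fp :
  finitely_presented (lie_gamma l i.+1) <-> finitely_presented (lie_gamma m i.+1).
Proof.
have [[_ _ pi_surj] _] := ext; have [z kerz] := gamma_map_finite_kernel.
have surj := gamma_map_surj i pi_surj.
by split; [exact: fp_quotient surj kerz|exact: fp_extension surj kerz].
Qed.

End CentralExtension.

Lemma trivial_central_extension (m : lieType K) i :
  exists (r : lieType K) (iota : lieHom r m) (pi : lieHom m m),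
    central_extension i iota pi.
Proof.
pose r := Subalgebra (ideal_subalgebra (set0_ideal m)).
have rangeE : range (@sub_lie_val K m r) = [set 0].
  apply/seteqP; split=> [_ [x _ <-]|_ ->]; first exact/asboolP/(sub_lieP x).
  by exists 0.
exists (sub_lie r), (@sub_lie_val K m r), idfun; split; last first.
  by rewrite rangeE rel_gamma0.
split; first exact: val_inj; first by rewrite rangeE.
by apply/seteqP; split=> // x _; exists x.
Qed.

End LowerCentral.

End Preliminaries.

Theorem theorem4p3 (K : fieldType) (m : lieType K) (i : nat)
    (m_fp : finitely_presented m) :
  [<-> finitely_presented (lie_gamma m i.+1);
       exists (r l : lieType K) (iota : lieHom r l) (pi : lieHom l m),
         central_extension i iota pi
         /\ finitely_presented (lie_gamma l i.+1);
       forall (r l : lieType K) (iota : lieHom r l) (pi : lieHom l m),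
         central_extension i iota pi ->
         finitely_presented (lie_gamma l i.+1)].
Proof.
have [r [iota [pi ext]]] := trivial_central_extension m i.
tfae.
- by move=> fp; exists r, m, iota, pi.
- move=> [r1 [l1 [iota1 [pi1 [ext1 fp]]]]] r2 l2 iota2 pi2 ext2.
  by apply/(central_extension_fp m_fp ext2)/(central_extension_fp m_fp ext1).
- by move=> all_fp; exact: all_fp ext.
Qed.
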